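(* For every positive integer $s$, the number of self-conjugate $(s,s+1,s+2)$-core partitions is $$\sum_{i\geq 0}\binom{\lfloor s/2\rfloor}{i}\binom{i}{\lfloor i/2\rfloor},$$ and this number equals the number of symmetric Motzkin paths of length $s$.
   Context: A partition $\lambda=(\lambda_1,\dots,\lambda_\ell)$ has Young diagram with $\lambda_i$ boxes in row $i$; its conjugate $\lambda'$ has $\lambda'_j$ equal to the number of boxes in column $j$, and $\lambda$ is self-conjugate if $\lambda'=\lambda$. The hook length of the box $(i,j)$ is $h(i,j)=\lambda_i+\lambda'_j-i-j+1$. For a positive integer $t$, $\lambda$ is a $t$-core if none of its hook lengths is a multiple of $t$; it is a $(t_1,\dots,t_p)$-core if it is a $t_i$-core for every $i$. A Motzkin path of length $n$ is a lattice path from $(0,0)$ to $(n,0)$ using steps $U=(1,1)$, $D=(1,-1)$, $F=(1,0)$ that never goes below the $x$-axis; it is symmetric if its reflection about the line $x=n/2$ is itself. *)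

(* Defs.v *)
From HB Require Import structures.
From mathcomp Require Import all_boot all_order all_algebra.
From mathcomp Require Import boolp classical_sets functions cardinality.

Set Implicit Arguments.
Unset Strict Implicit.
Unset Printing Implicit Defensive.

(* A partition is the weakly decreasing sequence of its positive parts;
   rows and columns are numbered from 0. *)
Definition is_partition (la : seq nat) : bool := sorted geq la && (0 \notin la).

Definition in_diagram (la : seq nat) (i j : nat) : bool := j < nth 0 la i.

(* The number of columns is the largest part, which is the head. *)
Definition conjugate (la : seq nat) : seq nat :=
  mkseq (fun j => count (fun part => j < part) la) (head 0 la).

Definition self_conjugate (la : seq nat) : bool := conjugate la == la.

(* la_i + la'_j - i - j + 1 in 1-based coordinates becomes
   la_i + la'_j - (i + j + 1) in 0-based ones; the subtraction does not
   truncate when (i, j) is a box of the diagram of a partition. *)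
Definition hook_length (la : seq nat) (i j : nat) : nat :=
  nth 0 la i + nth 0 (conjugate la) j - (i + j + 1).

Definition is_core (t : nat) (la : seq nat) : Prop :=
  forall i j, in_diagram la i j -> ~~ (t %| hook_length la i j).

Definition is_multicore (ts : seq nat) (la : seq nat) : Prop :=
  forall t, t \in ts -> is_core t la.

Definition self_conjugate_cores (ts : seq nat) : set (seq nat) :=
  [set la | [/\ is_partition la, self_conjugate la & is_multicore ts la]]%classic.

Inductive step := Up | Down | Flat.

Definition step_code (e : step) : option bool :=
  match e with Up => Some true | Down => Some false | Flat => None end.

Definition step_decode (c : option bool) : step :=
  match c with Some true => Up | Some false => Down | None => Flat end.

Lemma step_codeK : cancel step_code step_decode.
Proof. by case. Qed.

HB.instance Definition _ := Finite.copy step (can_type step_codeK).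

Definition displacement (e : step) : int * int :=
  match e with
  | Up => (1, 1)%R
  | Down => (1, -1)%R
  | Flat => (1, 0)%R
  end.

Definition vertices (p : seq step) : seq (int * int) :=
  (0 :: scanl (fun v e => v + displacement e) 0 p)%R.

Definition is_motzkin (n : nat) (p : seq step) : bool :=
  all (fun v : int * int => 0 <= v.2)%R (vertices p)
  && (last (0, 0)%R (vertices p) == (n%:Z, 0)%R).

(* Reflection about the line x = n/2. *)
Definition reflect_point (n : nat) (v : int * int) : int * int :=
  (n%:Z - v.1, v.2)%R.

(* The reflection reverses the left-to-right order of the vertices. *)
Definition is_symmetric (n : nat) (p : seq step) : bool :=
  rev (map (reflect_point n) (vertices p)) == vertices p.

(* Main.v *)
(* Place a bead of a Maya diagram at la_i - i - 1 for every row i (numbered from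
   0).  The partition is self-conjugate iff exactly one of x and -1-x is a bead,
   and a t-core iff the bead set is stable under x |-> x - t.  On the
   (s+1)-abacus the bead set of an (s+1)-core is {x | 0 < c x} for a level
   function c on the integers with c (x + s + 1) = c x - 1; being also an s-core
   and an (s+2)-core means |c (x+1) - c x| <= 1, and self-conjugacy means
   c (s - x) = - c x.  Hence c vanishes at m = floor(s/2), satisfies
   c 0 = 0 or 1, and is determined by its values on [0, m]: the cores correspond
   to the walks with steps 1, 0, -1 of length m ending at height 0 or 1.

   A symmetric Motzkin path is determined by its first m steps, which form an
   arbitrary walk staying nonnegative; by the reflection principle these are
   equinumerous with the walks ending at height 0 or 1.  Sorting the latter by
   their number i of non-horizontal steps gives the sum. *)
Require Import Defs.
From HB Require Import structures.
From mathcomp Require Import all_boot all_order all_algebra.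
From mathcomp Require Import boolp classical_sets functions cardinality.
From mathcomp Require Import finmap zify.

Set Implicit Arguments.
Unset Strict Implicit.
Unset Printing Implicit Defensive.
Import Order.TTheory GRing.Theory Num.Theory.
Local Open Scope ring_scope.

(** * Counting walks *)

Definition rise (e : step) : int := (displacement e).2.
Definition height (p : seq step) (i : nat) : int := \sum_(e <- take i p) rise e.
Definition total_rise (p : seq step) : int := \sum_(e <- p) rise e.

Lemma big_step (F : step -> nat) :
  (\sum_(e : step) F e = F Up + F Flat + F Down)%N.
Proof.
rewrite (bigD1 Up) //= (bigD1 Flat) //= (bigD1 Down) //= big1 ?addn0 ?addnA //.
by case.
Qed.

Lemma card_word_cons n (Q : pred (seq step)) :
  #|[pred p : n.+1.-tuple step | Q p]|
  = (\sum_(e : step) #|[pred p : n.-tuple step | Q (e :: p)]|)%N.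
Proof.
under eq_bigr => e _ do rewrite -sum1_card.
rewrite pair_big_dep /= -sum1_card.
rewrite (reindex (fun ep : step * n.-tuple step => [tuple of ep.1 :: ep.2])) //=.
exists (fun p => (thead p, [tuple of behead p])) => [[e p] _|p _] /=.
  by congr pair; apply: val_inj.
by rewrite -tuple_eta.
Qed.

Lemma card_word0 (Q : pred (seq step)) :
  #|[pred p : 0.-tuple step | Q p]| = Q [::].
Proof.
rewrite (eq_card (B := if Q [::] then predT else pred0)); last first.
  by move=> p; rewrite tuple0 !inE; case: (Q [::]).
by case: (Q [::]); rewrite ?card0 // card_tuple.
Qed.

Definition walks (n : nat) (k : int) : nat :=
  #|[pred p : n.-tuple step | total_rise p == k]|.

Lemma walks0 k : walks 0 k = (k == 0).
Proof.
by rewrite /walks (card_word0 (fun p => total_rise p == k)) /total_rise big_nil eq_sym.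
Qed.

Lemma walksS n k :
  walks n.+1 k = (walks n (k - 1) + walks n k + walks n (k + 1))%N.
Proof.
rewrite /walks (card_word_cons n (fun p => total_rise p == k)) big_step.
by congr (_ + _ + _)%N; apply: eq_card => p;
  rewrite !inE /total_rise big_cons /rise /=; apply/eqP/eqP; lia.
Qed.

Fixpoint nonneg_from (k : int) (p : seq step) : bool :=
  if p is e :: q then (0 <= k) && nonneg_from (k + rise e) q else 0 <= k.

Lemma nonneg_fromP k p :
  reflect (forall i, 0 <= k + height p i) (nonneg_from k p).
Proof.
elim: p k => [|e p IH] k /=.
  apply: (iffP idP) => [k0 i|/(_ 0%N)];
    by rewrite /height ?big_nil addr0.
apply: (iffP andP) => [[k0 /IH H] [|i]|H].
- by rewrite /height take0 big_nil addr0.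
- by have := H i; rewrite /height /= big_cons addrA.
- split; first by have := H 0%N; rewrite /height take0 big_nil addr0.
  by apply/IH => i; have := H i.+1; rewrite /height /= big_cons addrA.
Qed.

(* The reflection principle in telescoped form: the sum over the displacements
   [j >= -k] of [walks n j - walks n (j + 2 k + 2)]. *)
Lemma card_nonneg_from n (k : nat) :
  #|[pred p : n.-tuple step | nonneg_from k%:Z p]|
  = (\sum_(0 <= j < k.+1.*2) walks n (j%:Z - k%:Z))%N.
Proof.
elim: n k => [|n IH] k.
  rewrite (card_word0 (nonneg_from k%:Z)) /=.
  under eq_bigr => j _ do rewrite walks0.
  rewrite (bigD1_seq k) ?mem_index_iota ?iota_uniq //=; last by lia.
  by rewrite subrr eqxx big1 // => j /eqP jk; case: eqP => //; lia.
(* For [k = 0] a down step leads to height -1, from which no word is admissible. *)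
have nil0 : #|[pred p : n.-tuple step | nonneg_from (-1) p]| = 0%N.
  by apply: eq_card0 => -[[|e p] Hp].
rewrite (card_word_cons n (nonneg_from k%:Z)) big_step.
under eq_bigr => j _ do rewrite walksS.
have stepE e : #|[pred p : n.-tuple step | nonneg_from k%:Z (e :: p)]|
    = #|[pred p : n.-tuple step | nonneg_from (k%:Z + rise e) p]|.
  by apply: eq_card => p; rewrite !inE.
(* Compared with the shifted sum, the window for [k + 1] has the extra displacements [k + 1] and
   [k + 2]. The window for [k - 1] lacks exactly these, so the two defects cancel. *)
have upE : #|[pred p : n.-tuple step | nonneg_from (k%:Z + 1) p]|
    = (\sum_(0 <= j < k.+1.*2) walks n (j%:Z - k%:Z - 1)
       + walks n k.+1%:Z + walks n k.+2%:Z)%N.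
  rewrite -PoszD addn1 IH doubleS 2?big_nat_recr //=; congr (_ + _ + _)%N.
  - by apply: eq_big_nat => j _; congr walks; lia.
  - by congr walks; lia.
  - by congr walks; lia.
have downE : (#|[pred p : n.-tuple step | nonneg_from (k%:Z + -1) p]|
    + walks n k.+1%:Z + walks n k.+2%:Z
    = \sum_(0 <= j < k.+1.*2) walks n (j%:Z - k%:Z + 1))%N.
  rewrite doubleS !big_nat_recr //=; congr (_ + _ + _)%N.
  - case: k {upE stepE} => [|k]; first by rewrite nil0 big_geq.
    have -> : k.+1%:Z + -1 = k by lia.
    by rewrite IH; apply: eq_big_nat => j _; congr walks; lia.
  - by congr walks; lia.
  - by congr walks; lia.
rewrite !stepE -[rise Up]/(1 : int) -[rise Flat]/(0 : int) -[rise Down]/(-1 : int).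
rewrite upE addr0 IH.
rewrite !big_split /= -downE; lia.
Qed.

(** * Sorting walks by their number of non-horizontal steps *)

(* [coin n (n + k)] counts the walks with [n] steps 1 or -1 and final height [k]. *)
Definition coin (n : nat) (z : int) : nat :=
  if z is Posz k then (if odd k then 0 else 'C(n, k./2))%N else 0%N.

Lemma coinS n z : coin n.+1 z = (coin n (z - 2) + coin n z)%N.
Proof.
case: z => [[|[|k]]|k] //; first by rewrite /= !bin0.
have -> : Posz k.+2 - 2 = k by lia.
by rewrite /= negbK; case: ifP => // _; rewrite binS addnC.
Qed.

Lemma sum_binS n (F : nat -> nat) :
  (\sum_(i < n.+2) 'C(n.+1, i) * F i
   = \sum_(i < n.+1) 'C(n, i) * (F i + F i.+1))%N.
Proof.
rewrite big_ord_recl /= bin0.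
under eq_bigr => i _ do rewrite /bump /= add1n binS mulnDl.
under [RHS]eq_bigr => i _ do rewrite mulnDr.
rewrite !big_split /= addnA; congr addn.
rewrite [RHS]big_ord_recl /= bin0; congr addn.
by rewrite big_ord_recr /= bin_small // addn0.
Qed.

(** Choose the [i] positions of the non-horizontal steps; these alone determine the final height.
    Formally, Pascal's rule gives both sides the same recurrence. *)
Lemma walks_coin n k :
  walks n k = (\sum_(i < n.+1) 'C(n, i) * coin i (i%:Z + k))%N.
Proof.
elim: n k => [|n IH] k.
  rewrite big_ord1 mul1n walks0 add0r; case: k => [[|k]|k] //=.
  by case: ifP => //; case: k.
rewrite walksS !IH (sum_binS n (fun i => coin i (i%:Z + k))) -!big_split.
apply: eq_bigr => i _ /=; rewrite -!mulnDr coinS; congr muln.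
have -> : i.+1%:Z + k - 2 = i%:Z + (k - 1) by lia.
have -> : i.+1%:Z + k = i%:Z + (k + 1) by lia.
lia.
Qed.

(** Only the height with the parity of [i] contributes; for odd [i] the symmetry of binomial
    coefficients is needed. *)
Lemma coin_central i : (coin i (i%:Z + 0) + coin i (i%:Z + 1) = 'C(i, i./2))%N.
Proof.
rewrite addr0 -PoszD addn1 /=; case: (boolP (odd i)) => oi /=; last by rewrite addn0.
rewrite add0n -bin_sub; first by congr binomial; lia.
lia.
Qed.

Lemma walks01 n :
  (walks n 0 + walks n 1 = \sum_(i < n.+1) 'C(n, i) * 'C(i, i./2))%N.
Proof.
rewrite !walks_coin -big_split; apply: eq_bigr => i _ /=.
by rewrite -mulnDr coin_central.
Qed.

Lemma card_nonneg n :
  #|[pred p : n.-tuple step | nonneg_from 0 p]| = (walks n 0 + walks n 1)%N.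
Proof. by rewrite card_nonneg_from !big_nat_recr //= big_geq. Qed.

(** * Symmetric Motzkin paths *)

Lemma height0 p : height p 0 = 0.
Proof. by rewrite /height take0 big_nil. Qed.

Lemma height_cons e p i : height (e :: p) i.+1 = rise e + height p i.
Proof. by rewrite /height /= big_cons. Qed.

Lemma height_size p : height p (size p) = total_rise p.
Proof. by rewrite /height take_size. Qed.

Lemma height_step p i : `|height p i.+1 - height p i| <= 1.
Proof.
elim: p i => [|e p IH] i; first by rewrite /height subrr.
case: i => [|i]; rewrite ?height_cons.
- by rewrite !height0 addr0 subr0; case: e.
- by rewrite opprD addrACA subrr add0r.
Qed.

Lemma height_inj n (p q : seq step) : size p = n -> size q = n ->
  (forall i, (i <= n)%N -> height p i = height q i) -> p = q.
Proof.
elim: n p q => [|n IH] [|d p] [|e q] //= [sp] [sq] H.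
have de : d = e.
  have := H 1%N isT; rewrite !height_cons !height0 !addr0.
  by case: (d); case: (e).
rewrite -de; congr cons; apply: IH => // i le_in.
by have := H i.+1 le_in; rewrite !height_cons de; apply: addrI.
Qed.

Definition step_of (z : int) : step :=
  if z == 1 then Up else if z == -1 then Down else Flat.

Definition word_of (n : nat) (h : nat -> int) : seq step :=
  mkseq (fun i => step_of (h i.+1 - h i)) n.

Lemma size_word_of n h : size (word_of n h) == n.
Proof. by rewrite size_mkseq. Qed.

Canonical word_of_tuple n h := Tuple (size_word_of n h).

Lemma height_word_of n (h : nat -> int) i : h 0%N = 0 ->
    (forall j, (j < n)%N -> `|h j.+1 - h j| <= 1) -> (i <= n)%N ->
  height (word_of n h) i = h i.
Proof.
move=> h0 hstep; elim: i => [|i IH] lt_in; first by rewrite height0.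
rewrite /height (take_nth Flat) ?size_mkseq // -cats1 big_cat big_seq1 /=.
rewrite -[\sum_(_ <- _) _]/(height _ _) IH ?(ltnW lt_in) // nth_mkseq //.
have := hstep i lt_in; rewrite /step_of; case: eqP => [|?]; last case: eqP => [|?];
  rewrite /rise /=; lia.
Qed.

Lemma size_vertices p : size (vertices p) = (size p).+1.
Proof. by rewrite /= size_scanl. Qed.

Lemma nth_vertices p i : (i <= size p)%N ->
  nth (0, 0) (vertices p) i = (i%:Z, height p i).
Proof.
suff nthE v : (i <= size p)%N ->
    nth (0, 0) (v :: scanl (fun u e => u + displacement e) v p) i
    = (v.1 + i%:Z, v.2 + height p i).
  by move=> /nthE ->; rewrite !add0r.
elim: p i v => [|e p IH] [|i] [x y] //=.
- by rewrite height0 !addr0.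
- by rewrite height0 !addr0.
- rewrite ltnS => /IH ->; rewrite height_cons /=.
  by congr pair; [case: e => /=; lia | rewrite addrA].
Qed.

Lemma symmetricP n p : size p = n ->
  reflect (forall i, (i <= n)%N -> height p i = height p (n - i)) (is_symmetric n p).
Proof.
move=> sp; apply: (iffP eqP) => [symp i le_in|H].
  have := congr1 (fun l => nth (0, 0) l i) symp.
  rewrite nth_rev ?size_map ?size_vertices ?sp ?ltnS //.
  rewrite (nth_map (0, 0)) ?size_vertices ?sp; last by lia.
  by rewrite !nth_vertices ?sp ?subSS ?leq_subr // => -[_ ->].
apply: (@eq_from_nth _ (0, 0)) => [|i]; rewrite size_rev size_map //.
rewrite size_vertices sp ltnS => le_in.
rewrite nth_rev ?size_map ?size_vertices ?sp ?ltnS //.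
rewrite (nth_map (0, 0)) ?size_vertices ?sp; last by lia.
rewrite !nth_vertices ?sp ?subSS ?leq_subr //= /reflect_point /= -H //.
by congr pair; lia.
Qed.

Lemma motzkin_symmetricP n p : size p = n ->
  reflect (forall i, (i <= n)%N -> 0 <= height p i /\ height p i = height p (n - i))
          (is_motzkin n p && is_symmetric n p).
Proof.
move=> sp; apply: (iffP andP).
  move=> [/andP[/allP pos _] /(symmetricP sp) symp] i le_in; split; last exact: symp.
  have := pos (nth (0, 0) (vertices p) i); rewrite nth_vertices ?sp //; apply.
  by rewrite -nth_vertices ?sp // mem_nth // size_vertices sp.
move=> H; split; last by apply/(symmetricP sp) => i /H[].
apply/andP; split.
  apply/(all_nthP (0, 0)) => i; rewrite size_vertices ltnS => le_ip.
  by rewrite nth_vertices //=; rewrite sp in le_ip; case: (H i le_ip).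
rewrite (last_nth (0, 0)) size_vertices.
rewrite -[nth _ _ _]/(nth (0, 0) (vertices p) (size p)) nth_vertices // sp.
(* Symmetry equates the final height with the initial one, so the path ends on the axis. *)
by case: (H n (leqnn n)) => _ ->; rewrite subnn height0.
Qed.

(** [minn i (n - i)] is the distance to the nearer end: a word [q] of length [n./2] is followed by
    its mirror image, with a flat middle step when [n] is odd. *)
Definition unfold_word n (q : seq step) : n.-tuple step :=
  [tuple of word_of n (fun i => height q (minn i (n - i)))].

Lemma height_unfold_word n q i : (i <= n)%N ->
  height (unfold_word n q) i = height q (minn i (n - i)).
Proof.
apply: height_word_of => [|j lt_jn]; first by rewrite min0n height0.
have [->|[->|->]] : minn j.+1 (n - j.+1) = minn j (n - j)
    \/ (minn j.+1 (n - j.+1) = (minn j (n - j)).+1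
    \/ minn j (n - j) = (minn j.+1 (n - j.+1)).+1) by lia.
- by rewrite subrr.
- exact: height_step.
- by rewrite distrC height_step.
Qed.

Lemma card_symmetric_motzkin n :
  #|[pred p : n.-tuple step | is_motzkin n p && is_symmetric n p]|
  = #|[pred q : (n./2).-tuple step | nonneg_from 0 q]|.
Proof.
rewrite -(card_in_image (f := fun q : (n./2).-tuple step => unfold_word n q)).
  apply: eq_card => p; rewrite !inE.
  apply/idP/idP => [/(motzkin_symmetricP (size_tuple p)) H|]; last first.
    case/mapP => q; rewrite mem_enum inE => /nonneg_fromP pos ->.
    apply/(motzkin_symmetricP (size_tuple _)) => i le_in.
    rewrite !height_unfold_word ?leq_subr //.
    by split; [have := pos (minn i (n - i)); rewrite add0r | congr height; lia].
  have take_size : size (take n./2 p) == n./2 by rewrite size_takel ?size_tuple //; lia.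
  have takeE i : (i <= n./2)%N -> height (Tuple take_size) i = height p i.
    by move=> le; rewrite /height /= take_takel.
  apply/mapP; exists (Tuple take_size).
    rewrite mem_enum inE; apply/nonneg_fromP => i; rewrite add0r.
    have [le|lt] := leqP i n./2; first by rewrite takeE //; case: (H i) => //; lia.
    (* Past its end the truncated word keeps the height reached at [n./2]. *)
    rewrite {1}/height take_oversize /= ?(eqP take_size); last by lia.
    by rewrite -[X in _ <= X]/(height p _); case: (H n./2) => //; lia.
  apply: val_inj; apply: (height_inj (n := n)); rewrite ?size_tuple // => i le_in.
  rewrite height_unfold_word // takeE; last by lia.
  rewrite /minn; case: ifP => // _; by case: (H i).
move=> q r _ _ /= eq_qr; apply: val_inj.
apply: (height_inj (n := n./2)); rewrite ?size_tuple // => i le_in.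
have le : (i <= n)%N by lia.
have := height_unfold_word q le; rewrite eq_qr height_unfold_word //.
by rewrite (minn_idPl _) //; lia.
Qed.

(** * Maya diagrams of self-conjugate partitions *)

Lemma partition_nth_leq la i j : is_partition la -> (i <= j)%N ->
  (nth 0 la j <= nth 0 la i)%N.
Proof.
move=> /andP[la_sorted _] le_ij.
have [lt|ge] := ltnP j (size la); last by rewrite (nth_default 0 ge).
have tr : transitive geq by move=> y x z /= le_yx le_zy; apply: leq_trans le_zy le_yx.
have refl : reflexive geq by move=> x /=.
by apply: (sorted_leq_nth tr refl) => //; rewrite inE // (leq_ltn_trans le_ij).
Qed.

Lemma partition_size la i : is_partition la -> (i < size la)%N = (0 < nth 0 la i)%N.
Proof.
move=> /andP[_ la0]; apply/idP/idP => [lt|]; last first.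
  by apply: contraTT; rewrite -leqNgt => /(nth_default 0) ->.
by rewrite lt0n; apply: contraNneq la0 => <-; rewrite mem_nth.
Qed.

Lemma partition_inj la mu : is_partition la -> is_partition mu ->
  nth 0%N la =1 nth 0%N mu -> la = mu.
Proof.
move=> pla pmu eq_nth; apply: (eq_from_nth (x0 := 0%N)) => //.
apply/eqP; rewrite eqn_leq; apply/andP; split; rewrite leqNgt.
  by rewrite partition_size // eq_nth -partition_size // ltnn.
by rewrite partition_size // -eq_nth -partition_size // ltnn.
Qed.

Lemma ltn_count_geq la i j : sorted geq la ->
  (i < count (fun part => j < part) la)%N = (j < nth 0 la i)%N.
Proof.
elim: la i => [|a la IH] i /= la_sorted; first by rewrite nth_nil.
have sorted_la := path_sorted la_sorted.
have [lt_ja|le_aj] := ltnP j a; first by case: i => [|i] //=; rewrite add1n ltnS IH.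
have all0 : count (fun part => j < part)%N la = 0%N.
  apply/eqP; rewrite -leqn0 leqNgt -has_count; apply/hasPn => x x_la.
  rewrite -leqNgt (leq_trans _ le_aj) //.
  have tr : transitive geq by move=> y u v /= yu vy; apply: leq_trans vy yu.
  by have /allP := order_path_min tr la_sorted; apply.
rewrite all0 ltn0; case: i => [|i] /=; first by rewrite ltnNge le_aj.
by rewrite -IH // all0.
Qed.

Lemma nth_conjugate la j : is_partition la ->
  nth 0 (conjugate la) j = count (fun part => j < part)%N la.
Proof.
move=> pla; have [lt|ge] := ltnP j (head 0 la)%N; first by rewrite nth_mkseq.
rewrite nth_default ?size_mkseq //; apply/esym/eqP; rewrite -leqn0 leqNgt.
rewrite ltn_count_geq; last by case/andP: pla.
by rewrite -leqNgt nth0.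
Qed.

Lemma self_conjugateP la : is_partition la ->
  reflect (forall i j, (j < nth 0 la i)%N = (i < nth 0 la j)%N) (self_conjugate la).
Proof.
move=> pla; have sla : sorted geq la by case/andP: pla.
apply: (iffP eqP) => [conj_la i j|sym].
  by rewrite -[in RHS]conj_la nth_conjugate // ltn_count_geq.
apply: (eq_from_nth (x0 := 0%N)) => [|j _].
  rewrite size_mkseq -nth0; apply/eqP; rewrite eqn_leq; apply/andP.
  split; rewrite leqNgt; first by rewrite sym -partition_size // ltnn.
  by rewrite partition_size // -sym ltnn.
rewrite nth_conjugate //; apply/eqP; rewrite eqn_leq; apply/andP.
split; rewrite leqNgt; first by rewrite ltn_count_geq // sym ltnn.
by rewrite sym -ltn_count_geq // ltnn.
Qed.

(* Position of the [i]-th bead of the Maya diagram; the rows past the last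
   part supply the beads in the far negative range. *)
Definition bead (la : seq nat) (i : nat) : int := (nth 0%N la i)%:Z - i%:Z - 1.

Definition beads (la : seq nat) (x : int) : Prop := exists i, bead la i = x.

Lemma bead_decr la i j : is_partition la -> (i < j)%N -> bead la j < bead la i.
Proof.
by move=> pla lt_ij; have := partition_nth_leq pla (ltnW lt_ij); rewrite /bead; lia.
Qed.

(** Beads strictly decrease with the row, so the set determines them one by one from the largest
    down. *)
Lemma beads_inj la mu : is_partition la -> is_partition mu ->
  (forall x, beads la x <-> beads mu x) -> la = mu.
Proof.
move=> pla pmu eq_beads; apply: partition_inj => // i.
suff : bead la i = bead mu i by rewrite /bead; lia.
elim/ltn_ind: i => i IH.
have half rho nu : is_partition rho -> is_partition nu ->
    beads nu (bead rho i) -> (forall j, (j < i)%N -> bead rho j = bead nu j) ->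
    bead rho i <= bead nu i.
  move=> prho pnu [j nu_j] eq_lt; rewrite -nu_j.
  case: (ltngtP i j) => [lt_ij|lt_ji|-> //]; first exact/ltW/bead_decr.
  by have := bead_decr prho lt_ji; rewrite (eq_lt j lt_ji) nu_j ltxx.
apply/eqP; rewrite eq_le !half //.
- by apply/eq_beads; exists i.
- by move=> j /IH.
- by apply/eq_beads; exists i.
Qed.

(** * Symmetry and hook lengths in terms of beads *)

Section SelfConjugate.

Variables (la : seq nat) (pla : is_partition la).
Hypothesis symC : forall i j, (j < nth 0 la i)%N = (i < nth 0 la j)%N.

(** By symmetry a box has row [i] longer than [j] and row [j] longer than [i], and a non-box has
    neither; the sum is thus at least 1 or at most -1. *)
Lemma box_bead i j : in_diagram la i j = (0 < bead la i + bead la j + 1).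
Proof.
rewrite /in_diagram /bead; by have := symC i j; lia.
Qed.

Lemma hook_bead i j : in_diagram la i j ->
  (hook_length la i j)%:Z = bead la i + bead la j + 1.
Proof.
rewrite /hook_length /bead nth_conjugate // => box_ij.
have -> : count (fun part => j < part)%N la = nth 0%N la j.
  have /eqP {2}<- : self_conjugate la by apply/self_conjugateP.
  by rewrite nth_conjugate.
by move: box_ij (box_ij); rewrite {1}/in_diagram symC /in_diagram; lia.
Qed.

Lemma bead_add_neq i j : bead la i + bead la j + 1 <> 0.
Proof. by rewrite /bead; have := symC i j; lia. Qed.

Lemma beads_sym x : ~ beads la (-1 - x) <-> beads la x.
Proof.
have nonneg (n : nat) : beads la n%:Z \/ beads la (-1 - n%:Z).
  have ex_le : exists i, (nth 0 la i <= n + i.+1)%N.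
    by exists (size la); rewrite nth_default.
  (* Row [i] is the first whose bead is at most [n]. If that bead is not [n], then row [n + i] has
     exactly [i] boxes and its bead is [-1 - n]. *)
  have [i le_i min_i] := ex_minnP ex_le.
  have [eq_i|ne_i] := eqVneq (nth 0%N la i) (n + i.+1)%N.
    by left; exists i; rewrite /bead eq_i; lia.
  right; exists (n + i)%N; rewrite /bead.
  have le1 : (nth 0 la (n + i) <= i)%N by rewrite leqNgt -symC; lia.
  suff : (i <= nth 0 la (n + i))%N by lia.
  case: i le_i min_i ne_i le1 => // i _ min_i _ _.
  by rewrite -symC ltnNge; apply/negP => /min_i; lia.
have cover : beads la x \/ beads la (-1 - x).
  case: x => n //; rewrite NegzE.
  have -> : -1 - - n.+1%:Z = n%:Z by lia.
  have -> : - n.+1%:Z = -1 - n%:Z by lia.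
  by case: (nonneg n); [right|left].
split; first by case: cover.
by move=> [i bi] [j bj]; apply: (@bead_add_neq i j); lia.
Qed.

Lemma beads_coreP t : (0 < t)%N ->
  is_core t la <-> (forall x, beads la x -> beads la (x - t%:Z)).
Proof.
move=> t_gt0; split=> [core x [i bi]|closed i j box_ij].
  (* If [x - t] were not a bead, its mirror image would be the bead of some row [j], giving a hook
     of length [t]. *)
  apply/beads_sym => -[j bj].
  have box_ij : in_diagram la i j by rewrite box_bead; lia.
  have := core i j box_ij.
  suff -> : hook_length la i j = t by rewrite dvdnn.
  by apply/eqP; rewrite -eqz_nat hook_bead //; lia.
apply/negP => /dvdnP[k def_hook].
(* Subtracting [t] from bead [i], [k] times over, reaches the mirror image of bead [j], which cannot
   be a bead. *)
have closed_iter n x : beads la x -> beads la (x - (n * t)%:Z).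
  elim: n => [|n IH] bx; first by rewrite subr0.
  by have := closed _ (IH bx); congr beads; lia.
have /beads_sym[] : beads la (-1 - bead la j).
  have := closed_iter k (bead la i); rewrite -def_hook hook_bead //.
  have -> : bead la i - (bead la i + bead la j + 1) = -1 - bead la j by lia.
  by apply; exists i.
by exists j; lia.
Qed.

End SelfConjugate.

(** * Self-conjugate partitions from their nonnegative beads *)

(* Nests the symmetric hooks with arms [D]: each hook is wrapped around the
   diagram built from the later ones. *)
Fixpoint nested_hooks (D : seq nat) : seq nat :=
  if D is x :: E then x.+1 :: mkseq (fun i => (nth 0 (nested_hooks E) i).+1) x
  else [::].

Lemma size_nested_hooks D : size (nested_hooks D) = nth 0%N (nested_hooks D) 0.
Proof. by case: D => //= x E; rewrite size_mkseq. Qed.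

Lemma nth_nested_hooks_cons x E i :
  nth 0%N (nested_hooks (x :: E)) i.+1
  = (if i < x then (nth 0 (nested_hooks E) i).+1 else 0)%N.
Proof.
have [lt|ge] := ltnP i x; first by rewrite /= nth_mkseq.
by rewrite nth_default //= size_mkseq ltnS.
Qed.

Lemma size_nested_hooks_cons x E : sorted gtn (x :: E) ->
  (size (nested_hooks E) <= x)%N.
Proof. by case: E => //= y E /andP[lt_yx _]; rewrite size_mkseq. Qed.

Lemma nested_hooks_sym D : sorted gtn D -> forall i j,
  (j < nth 0 (nested_hooks D) i)%N = (i < nth 0 (nested_hooks D) j)%N.
Proof.
elim: D => [|x E IH] sD i j; first by rewrite !nth_nil.
have {}IH := IH (path_sorted sD); have le_x := size_nested_hooks_cons sD.
have inside k l : (l < nth 0 (nested_hooks E) k)%N -> (k < x)%N.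
  move=> lt; apply: leq_trans le_x; rewrite ltnNge; apply/negP => /(nth_default 0) eq0.
  by rewrite eq0 in lt.
case: i j => [|i] [|j]; rewrite ?nth_nested_hooks_cons //= ?ltnS.
- by case: ifP.
- by case: ifP.
have := inside i j; have := inside j i; have := IH i j.
by case: ifP; case: ifP => //; rewrite ?ltnS; lia.
Qed.

Lemma partition_nested_hooks D : sorted gtn D -> is_partition (nested_hooks D).
Proof.
elim: D => [|x E IH] // sD; have := IH (path_sorted sD) => pE.
have le_x := size_nested_hooks_cons sD.
apply/andP; split; last first.
  by rewrite /= inE /=; apply/negP => /mapP[].
apply/(sortedP 0%N) => i _.
suff : (nth 0 (nested_hooks (x :: E)) i.+1 <= nth 0 (nested_hooks (x :: E)) i)%N.
  by [].
rewrite nth_nested_hooks_cons; case: ifP => // lt_ix.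
case: i lt_ix => [|i] lt_ix.
  by rewrite ltnS (leq_trans _ le_x) // size_nested_hooks.
by rewrite nth_nested_hooks_cons (ltnW lt_ix) ltnS partition_nth_leq.
Qed.

(** Wrapping a hook raises both the length and the index of an inner row by one, so nonnegative
    beads stay in place and [x] is added; empty rows have negative beads. *)
Lemma beads_nested_hooks D (n : nat) : sorted gtn D ->
  beads (nested_hooks D) n%:Z <-> n \in D.
Proof.
elim: D => [|x E IH] sD.
  by split=> // -[i]; rewrite /bead nth_nil; lia.
have {}IH := IH (path_sorted sD); have le_x := size_nested_hooks_cons sD.
rewrite inE; split=> [[[|i]]|/predU1P[->|/IH[i b_i]]].
- by rewrite /bead /= => /eqP; lia.
- rewrite /bead nth_nested_hooks_cons; case: ifP => [_ b_i|_]; last by lia.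
  by apply/orP; right; apply/IH; exists i; rewrite /bead; lia.
- by exists 0%N; rewrite /bead /=; lia.
exists i.+1; rewrite -b_i /bead nth_nested_hooks_cons ifT; first by lia.
apply: leq_trans le_x; rewrite ltnNge; apply/negP => /(nth_default 0%N).
by move: b_i; rewrite /bead; lia.
Qed.

(** * Level functions *)

(* [c x] is the number such that [x + s.+1 * k] is a bead iff [k < c x]. *)
Definition is_level (s : nat) (c : int -> int) : Prop :=
  [/\ forall x : int, c (x + s.+1%:Z) = c x - 1,
      forall x : int, c (s%:Z - x) = - c x
    & forall x : int, `|c (x + 1) - c x| <= 1].

Section Level.

Variables (s : nat) (c : int -> int).
Hypothesis lev : is_level s c.

Lemma level_shift (x k : int) : c (x + s.+1%:Z * k) = c x - k.
Proof.
case: lev => shift _ _; elim/int_ind: k => [|n IH|n IH].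
- by rewrite mulr0 addr0 subr0.
- have -> : x + s.+1%:Z * n.+1%:Z = x + s.+1%:Z * n%:Z + s.+1%:Z by lia.
  by rewrite shift IH; lia.
- have := shift (x + s.+1%:Z * - n.+1%:Z).
  have -> : x + s.+1%:Z * - n.+1%:Z + s.+1%:Z = x + s.+1%:Z * - n%:Z by lia.
  by rewrite IH; lia.
Qed.

Lemma level_compl (x : int) : c (-1 - x) = 1 - c x.
Proof.
case: lev => shift anti _; have := shift (-1 - x).
have -> : -1 - x + s.+1%:Z = s%:Z - x by lia.
by rewrite anti; lia.
Qed.

(** For even [s] the midpoint is its own mirror image; for odd [s] its mirror image is its right
    neighbour, and opposite integers differing by at most 1 vanish. *)
Lemma level_mid : c (s./2)%:Z = 0.
Proof.
case: lev => shift anti lip; have := anti (s./2)%:Z; have := lip (s./2)%:Z.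
have [od|ev] := boolP (odd s).
  have -> : s%:Z - (s./2)%:Z = (s./2)%:Z + 1 by lia.
  lia.
have -> : s%:Z - (s./2)%:Z = (s./2)%:Z by lia.
lia.
Qed.

(** The values at 0 and -1 sum to 1 and differ by at most 1. *)
Lemma level_start : (c 0 == 0) || (c 0 == 1).
Proof.
case: lev => shift anti lip; have := level_compl 0; have := lip (-1).
rewrite addNr subr0.
by move: (c 0) (c (-1)) => u v; lia.
Qed.

Lemma level_bound (n : nat) : c n%:Z <= `|c 0| + n%:Z.
Proof.
case: lev => _ _ lip; elim: n => [|n IH]; first by rewrite addr0 ler_norm.
have := lip n%:Z; rewrite -PoszD addn1; move: IH; move: `|c 0| => b.
lia.
Qed.

Lemma level_vanish : exists M : nat, forall n : nat, 0 < c n%:Z -> (n < M)%N.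
Proof.
have bound := level_bound; move: `|c 0| (normr_ge0 (c 0)) bound => b b_ge0 bound.
(* Beyond this bound the quotient by [s.+1] exceeds [b + s], the largest value that [c] can take on
   the first period. *)
exists (s.+1 * (`|b|%N + s).+1)%N => n cn_gt0; rewrite ltnNge; apply/negP => le_Mn.
have := level_shift (n %% s.+1)%N%:Z (n %/ s.+1)%N%:Z.
rewrite -PoszM -PoszD addnC mulnC -divn_eq => cn.
have := bound (n %% s.+1)%N; have := ltn_pmod n (ltn0Sn s).
have : (`|b|%N + s < n %/ s.+1)%N by rewrite leq_divRL // mulnC.
lia.
Qed.

Lemma level_partition : exists la,
  [/\ is_partition la, self_conjugate la & forall x : int, beads la x <-> 0 < c x].
Proof.
have [M vanish] := level_vanish.
(* The arms are the nonnegative positions of positive level; the negative positions then follow by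
   complementation. *)
pose D := rev [seq n <- iota 0 M | 0 < c n%:Z].
have sD : sorted gtn D.
  rewrite /D rev_sorted; apply: sorted_filter; last exact: iota_ltn_sorted.
  by move=> y x z /=; apply: ltn_trans.
have pla := partition_nested_hooks sD; have symla := nested_hooks_sym sD.
exists (nested_hooks D); split=> //; first exact/self_conjugateP.
have beads_nat (n : nat) : beads (nested_hooks D) n%:Z <-> 0 < c n%:Z.
  apply: iff_trans (beads_nested_hooks _ sD) _; rewrite mem_rev mem_filter mem_iota /=.
  by split=> [/andP[]|cn] //; rewrite cn /= add0n vanish.
case=> n //; rewrite NegzE; have -> : - n.+1%:Z = -1 - n%:Z by lia.
rewrite level_compl; apply: iff_trans (iff_sym (beads_sym pla symla _)) _.
have -> : -1 - (-1 - n%:Z) = n%:Z by lia.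
split=> [nb|lt bn]; first by have := contra_not (proj2 (beads_nat n)) nb; lia.
by have := proj1 (beads_nat n) bn; lia.
Qed.

End Level.

Lemma level_inj s c d : is_level s c -> is_level s d ->
  (forall i, (i <= s./2)%N -> c i%:Z = d i%:Z) -> c =1 d.
Proof.
move=> lc ld eq_cd.
have eq_s i : (i <= s)%N -> c i%:Z = d i%:Z.
  move=> le_is; have [/eq_cd//|lt] := leqP i s./2.
  case: lc ld => [_ cA _] [_ dA _].
  have := eq_cd (s - i)%N; have -> : (s - i)%N%:Z = s%:Z - i%:Z by lia.
  by rewrite cA dA => eq_opp; apply: oppr_inj; apply: eq_opp; lia.
move=> x; have -> : x = (`|(x %% s.+1)%Z|)%N%:Z + s.+1%:Z * (x %/ s.+1%:Z)%Z by lia.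
by rewrite (level_shift lc) (level_shift ld) eq_s //; lia.
Qed.

Lemma level_of_pos_inj s c d : is_level s c -> is_level s d ->
  (forall x : int, 0 < c x <-> 0 < d x) -> c =1 d.
Proof.
move=> lc ld eq_cd x.
(* Both shifts bring one of the levels to exactly 1; positivity of the other gives the two
   inequalities. *)
have := eq_cd (x + s.+1%:Z * (c x - 1)); have := eq_cd (x + s.+1%:Z * (d x - 1)).
by rewrite !(level_shift lc) !(level_shift ld); lia.
Qed.

(** * Level functions and simultaneous cores *)

(** Going back by [s] or [s.+2] is going back one period, which gains 1, and then a unit step, which
    loses at most 1. *)
Lemma level_cores s c la : (0 < s)%N -> is_level s c ->
    is_partition la -> self_conjugate la ->
    (forall x : int, beads la x <-> 0 < c x) -> is_multicore [:: s; s.+1; s.+2] la.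
Proof.
move=> s_gt0 lev pla /(self_conjugateP pla) symla beadsE t.
case: lev => shift _ lip.
have sub_core u : (0 < u)%N -> (forall x : int, 0 < c x -> 0 < c (x - u%:Z)) ->
    is_core u la.
  move=> u_gt0 H; apply/(beads_coreP pla symla u_gt0) => x /beadsE cx.
  by apply/beadsE; apply: H.
rewrite !inE => /or3P[]/eqP->; apply: sub_core => // x cx.
- have := shift (x - s%:Z); have -> : x - s%:Z + s.+1%:Z = x + 1 by lia.
  by have := lip x; lia.
- have := shift (x - s.+1%:Z); have -> : x - s.+1%:Z + s.+1%:Z = x by lia.
  by lia.
- have := shift (x - s.+2%:Z); have -> : x - s.+2%:Z + s.+1%:Z = x - 1 by lia.
  have := lip (x - 1); have -> : x - 1 + 1 = x by lia.
  by lia.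
Qed.

Lemma threshold (P : int -> Prop) (a b : int) : P a -> ~ P b ->
    (forall k : int, P (k + 1) -> P k) ->
  exists K : int, forall k : int, P k <-> k < K.
Proof.
move=> Pa nPb down.
have downn n k : P (k + n%:Z) -> P k.
  elim: n => [|n IH]; first by rewrite addr0.
  by move=> H; apply: IH; apply: down; move: H; congr P; lia.
have downle k l : k <= l -> P l -> P k.
  move=> le_kl; have -> : l = k + `|l - k|%N%:Z by lia.
  exact: downn.
have ex : exists n, `[< ~ P (a + n%:Z) >].
  exists `|b - a|%N; apply/asboolP => Pb; apply: nPb.
  by apply: downle Pb; lia.
have [n /asboolP nPn min_n] := ex_minnP ex.
exists (a + n%:Z) => k; split=> [Pk|lt_k].
  by rewrite ltNge; apply/negP => le_k; apply: nPn; apply: downle Pk.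
have [le_ka|lt_ak] := lerP k a; first exact: downle Pa.
have [Pk//|nPk] := EM (P k).
have := min_n `|k - a|%N; have -> : a + `|k - a|%N%:Z = k by lia.
by move/asboolP: nPk => nPk /(_ nPk); lia.
Qed.

Lemma cores_level s la : (0 < s)%N -> is_partition la -> self_conjugate la ->
    is_multicore [:: s; s.+1; s.+2] la ->
  exists2 c, is_level s c & forall x : int, beads la x <-> 0 < c x.
Proof.
move=> s_gt0 pla /(self_conjugateP pla) symla cores.
have closed u : u \in [:: s; s.+1; s.+2] ->
    forall x : int, beads la x -> beads la (x - u%:Z).
  move=> u_in; apply/(beads_coreP pla symla); last exact: cores.
  by move: u_in; rewrite !inE => /or3P[]/eqP->.
have /choice[c cE] : forall x : int, exists K : int,
    forall k : int, beads la (x + s.+1%:Z * k) <-> k < K.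
  move=> x; apply: (@threshold _ (- (size la + `|x|%N).+1%:Z)
    ((size la).+1 + nth 0 la 0 + `|x|%N)%N%:Z).
  - exists `|(s.+1%:Z * (size la + `|x|%N).+1%:Z - x - 1)%R|%N.
    by rewrite /bead nth_default; nia.
  - by move=> [i]; rewrite /bead; have := partition_nth_leq pla (leq0n i); nia.
  - move=> k /(closed s.+1); rewrite !inE eqxx orbT => /(_ isT).
    by have -> : x + s.+1%:Z * (k + 1) - s.+1%:Z = x + s.+1%:Z * k by lia.
have leP x y j :
    (forall k : int, beads la (x + s.+1%:Z * k) -> beads la (y + s.+1%:Z * (k + j))) ->
    c x + j <= c y.
  move=> H; have /H /cE : beads la (x + s.+1%:Z * (c x - 1)) by apply/cE; lia.
  lia.
exists c; last by move=> x; have := cE x 0; rewrite mulr0 addr0.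
split=> x.
- have shiftE k : k < c (x + s.+1%:Z) <-> k + 1 < c x.
    apply: iff_trans (iff_sym (cE _ k)) (iff_trans _ (cE x (k + 1))).
    by have -> : x + s.+1%:Z + s.+1%:Z * k = x + s.+1%:Z * (k + 1) by lia.
  have := shiftE (c (x + s.+1%:Z) - 1); have := shiftE (c x - 2).
  lia.
- have antiE k : k < c (s%:Z - x) <-> ~ (-1 - k < c x).
    apply: iff_trans (iff_sym (cE _ k)) _.
    apply: iff_trans (iff_sym (beads_sym pla symla _)) _.
    have -> : -1 - (s%:Z - x + s.+1%:Z * k) = x + s.+1%:Z * (-1 - k) by lia.
    by split=> nb /cE.
  have := antiE (c (s%:Z - x) - 1); have := antiE (- c x - 1).
  lia.
- have up : c x + (-1) <= c (x + 1).
    apply: leP => k /(closed s); rewrite !inE eqxx => /(_ isT).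
    by congr beads; lia.
  have down : c (x + 1) + (-1) <= c x.
    apply: leP => k /(closed s.+2); rewrite !inE eqxx !orbT => /(_ isT).
    by congr beads; lia.
  lia.
Qed.

(* Both subtractions truncate, and this is intended: for a residue [r] only one
   of the two heights can be nonzero, the first for [r < s./2], the second on the
   mirror image of this range. *)
Definition level_of (s : nat) (p : seq step) (x : int) : int :=
  let r := `|(x %% s.+1)%Z|%N in
  height p (s./2 - r) - height p (s./2 - (s - r)) - (x %/ s.+1)%Z.

Lemma level_ofE s p x (i : nat) k : (i <= s)%N -> x = i%:Z + s.+1%:Z * k ->
  level_of s p x = height p (s./2 - i) - height p (s./2 - (s - i)) - k.
Proof.
move=> le_is ->; rewrite /level_of.
have small : 0 <= i%:Z < `|s.+1%:Z| by lia.
by rewrite mulrC (addrC i%:Z) divzMDl // modzMDl divz_small // modz_small // addr0.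
Qed.

Lemma is_level_of s p : (0 < s)%N -> size p = s./2 ->
  (total_rise p == 0) || (total_rise p == 1) -> is_level s (level_of s p).
Proof.
move=> s_gt0 sp tot.
have decomp (x : int) :
    exists i : nat, exists2 k : int, (i <= s)%N & x = i%:Z + s.+1%:Z * k.
  by exists `|(x %% s.+1)%Z|%N, (x %/ s.+1)%Z; lia.
split=> x; have [i [k le_is ->]] := decomp x.
- rewrite (level_ofE _ (i := i) (k := k + 1)) ?(level_ofE _ (i := i) (k := k)) //; lia.
- rewrite (level_ofE _ (i := s - i) (k := - k)) ?leq_subr //; last by lia.
  by rewrite (level_ofE _ (i := i) (k := k)) // subKn //; lia.
rewrite (level_ofE p le_is erefl).
have [lt_is|ge_is] := ltnP i s; last first.
  have -> : i = s by lia.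
  rewrite (level_ofE _ (i := 0%N) (k := k + 1)) //; last by lia.
  rewrite !subn0 subnn subn0 -[X in height p X]sp height_size.
  have -> : (s./2 - s = 0)%N by lia.
  by rewrite height0; lia.
rewrite (level_ofE _ (i := i.+1) (k := k)) //; last by lia.
have [lt_im|ge_im] := ltnP i s./2.
  have -> : (s./2 - (s - i.+1) = 0)%N by lia.
  have -> : (s./2 - (s - i) = 0)%N by lia.
  have := height_step p (s./2 - i.+1); rewrite -subSn // subSS height0.
  lia.
have -> : (s./2 - i = 0)%N by lia.
have -> : (s./2 - i.+1 = 0)%N by lia.
have [lt|ge] := ltnP (s - i.+1) s./2; last first.
  have -> : (s./2 - (s - i.+1) = 0)%N by lia.
  have -> : (s./2 - (s - i) = 0)%N by lia.
  by lia.
have := height_step p (s./2 - (s - i)).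
have -> : ((s./2 - (s - i)).+1 = s./2 - (s - i.+1))%N by lia.
by lia.
Qed.

Lemma card_eq_image (T : finType) (U : choiceType) (P : pred T) (A : set U) (f : T -> U) :
    (forall x, P x -> A (f x)) -> {in P &, injective f} ->
    (forall y, A y -> exists2 x, P x & y = f x) ->
  (A #= `I_#|P|)%card.
Proof.
move=> fA f_inj f_surj.
have -> : A = [set` [fset f x | x in enum P]%fset]%classic.
  apply/seteqP; split=> y /=.
    by move=> /f_surj[x Px ->]; apply/imfsetP; exists x => //=; rewrite mem_enum.
  by move=> /imfsetP[x /=]; rewrite mem_enum => Px ->; apply: fA.
apply/card_eq_fsetP; rewrite card_in_imfset //=; last first.
  by move=> x y; rewrite !mem_enum; apply: f_inj.
by rewrite cardE undup_id ?enum_uniq.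
Qed.

Lemma card_self_conjugate_cores s : (0 < s)%N ->
  (self_conjugate_cores [:: s; s.+1; s.+2] #= `I_(walks s./2 0 + walks s./2 1))%card.
Proof.
move=> hs.
pose P := [pred p : (s./2).-tuple step | (total_rise p == 0) || (total_rise p == 1)].
have -> : (walks s./2 0 + walks s./2 1 = #|P|)%N.
  rewrite /walks -cardUI [X in (_ + X)%N]eq_card0 ?addn0; last first.
    by move=> p; rewrite !inE; apply/negP; lia.
  by apply: eq_card => p; rewrite !inE.
have lev (p : (s./2).-tuple step) : P p -> is_level s (level_of s p).
  by move=> Pp; apply: is_level_of; rewrite ?size_tuple.
have ex_la (p : (s./2).-tuple step) : exists la, P p ->
    [/\ is_partition la, self_conjugate la
      & forall x : int, beads la x <-> 0 < level_of s p x].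
  have [/lev/level_partition[la H]|nP] := boolP (P p); first by exists la.
  by exists [::].
have [f fP] := choice ex_la.
apply: (card_eq_image (f := f)) => [p Pp|p q Pp Pq eq_f|la [pla sla cla]].
- by have [pla sla bE] := fP p Pp; split=> //; apply: level_cores (lev p Pp) _ _ bE.
- have [_ _ pE] := fP p Pp; have [_ _ qE] := fP q Pq.
  have eq_lev : level_of s p =1 level_of s q.
    apply: level_of_pos_inj (lev p Pp) (lev q Pq) _ => x.
    by rewrite -pE eq_f.
  apply: val_inj; apply: (height_inj (n := s./2)); rewrite ?size_tuple // => i le_i.
  have := eq_lev (s./2 - i)%N%:Z.
  rewrite !(level_ofE _ (i := (s./2 - i)%N) (k := 0)) ?mulr0 ?addr0 //; try by lia.
  have -> : (s./2 - (s - (s./2 - i)) = 0)%N by lia.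
  by rewrite subKn // !height0 !subr0.
have [c lc bE] := cores_level hs pla sla cla.
have mid := level_mid lc; have := level_start lc; case: (lc) => _ _ lip start.
pose q := word_of s./2 (fun j => c (s./2 - j)%N%:Z).
have q_height i : (i <= s./2)%N -> height q i = c (s./2 - i)%N%:Z.
  apply: height_word_of => [|j lt_j]; first by rewrite subn0.
  have := lip (s./2 - j.+1)%N%:Z.
  have -> : (s./2 - j.+1)%N%:Z + 1 = (s./2 - j)%N%:Z by lia.
  by rewrite distrC.
have Pq : P [tuple of q].
  by rewrite /= -height_size (eqP (size_word_of _ _)) q_height // subnn.
exists [tuple of q] => //; have [pq _ qE] := fP _ Pq.
apply: beads_inj => // x; rewrite bE qE.
rewrite (level_inj lc (lev _ Pq)) // => i le_i.
rewrite (level_ofE _ (i := i) (k := 0)) ?mulr0 ?addr0 //; last by lia.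
have -> : (s./2 - (s - i) = 0)%N by lia.
by rewrite height0 !subr0 /= q_height ?leq_subr // subKn.
Qed.

Local Close Scope ring_scope.
Unset Implicit Arguments.

Theorem theorem3p5 (s : nat) (hs : 0 < s) :
  let N := \sum_(i < (s./2).+1) 'C(s./2, i) * 'C(i, i./2) in
  (self_conjugate_cores [:: s; s.+1; s.+2] #= `I_N)%card
  /\ #|[pred p : s.-tuple step | is_motzkin s p && is_symmetric s p]| = N.
Proof.
rewrite /= -walks01; split; first exact: card_self_conjugate_cores.
by rewrite card_symmetric_motzkin card_nonneg.
Qed.
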